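(* Let $\Omega\neq\mathbb{R}^n$ be a convex domain in $\mathbb{R}^n$. The Hilbert metric $H_\Omega$ satisfies: (a) $H_\Omega(x,y)\ge0$ and $H_\Omega(x,x)=0$ for all $x,y\in\Omega$. (b) $H_\Omega(x,z)\le H_\Omega(x,y)+H_\Omega(y,z)$ for all $x,y,z\in\Omega$. (c) $H_\Omega$ is projective, that is, $H_\Omega(x,z)=H_\Omega(x,y)+H_\Omega(y,z)$ whenever $x,z\in\Omega$ and $y$ is a point on the affine segment $[x,z]$. (d) $H_\Omega$ is symmetric: $H_\Omega(x,y)=H_\Omega(y,x)$ for all $x,y\in\Omega$. (e) $H_\Omega$ is separating, that is, $x\neq y\Rightarrow H_\Omega(x,y)>0$, if and only if $\Omega$ does not contain any affine line. (f) $H_\Omega$ is unbounded.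
   Context: A convex domain is a non-empty open convex subset of $\mathbb{R}^n$. For $x\ne y$ in $\Omega$ let $R(x,y)=\{x+t(y-x): t\ge 0\}$. The Funk metric is $F_\Omega(x,x)=0$ and, for $x\ne y$, $F_\Omega(x,y)=\log\frac{|x-a|}{|y-a|}$ where $a$ is the unique point of $R(x,y)\cap\partial\Omega$ if $R(x,y)\not\subset\Omega$, and $F_\Omega(x,y)=0$ if $R(x,y)\subset\Omega$. The Hilbert metric is $H_\Omega(x,y)=\frac12\left(F_\Omega(x,y)+F_\Omega(y,x)\right)$. *)

(* Defs.v *)
From mathcomp Require Import all_boot all_order all_algebra.
From mathcomp Require Import boolp classical_sets set_interval reals.
From mathcomp Require Import topology normedtype convex exp.

Set Implicit Arguments.
Unset Strict Implicit.
Unset Printing Implicit Defensive.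

Import Order.TTheory GRing.Theory Num.Theory.
Import numFieldNormedType.Exports.

Local Open Scope classical_set_scope.
Local Open Scope ring_scope.

Section HilbertGeometry.
Context {R : realType} {n : nat}.
Implicit Types (Omega : set 'rV[R]_n) (x y : 'rV[R]_n).

(* The topology on 'rV[R]_n is the product topology, i.e. the usual one. *)
Definition convex_domain Omega : Prop :=
  [/\ Omega !=set0, open Omega & convex_set Omega].

Definition boundary Omega : set 'rV[R]_n := closure Omega `\` Omega°.

(* The library norm on 'rV[R]_n is the sup norm, hence this definition. *)
Definition euclid_norm x : R := Num.sqrt (\sum_(i < n) x ord0 i ^+ 2).

Definition ray x y : set 'rV[R]_n :=
  [set x + t *: (y - x) | t in [set t : R | 0 <= t]].

Definition segment x y : set 'rV[R]_n :=
  [set x + t *: (y - x) | t in [set t : R | 0 <= t <= 1]].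

(* An affine line when x != y. *)
Definition line x y : set 'rV[R]_n :=
  [set x + t *: (y - x) | t in [set: R]].

(* For x != y in a convex domain that does not contain [ray x y], the
   intersection is a singleton; the default value 0 is only returned when the
   intersection is empty. *)
Definition exit_point Omega x y : 'rV[R]_n :=
  xget 0 (ray x y `&` boundary Omega).

Definition funk Omega x y : R :=
  if x == y then 0
  else if `[< ray x y `<=` Omega >] then 0
  else let a := exit_point Omega x y in
       ln (euclid_norm (x - a) / euclid_norm (y - a)).

Definition hilbert Omega x y : R :=
  2^-1 * (funk Omega x y + funk Omega y x).

End HilbertGeometry.

(* Main.v *)
Require Import Defs.
From mathcomp Require Import all_boot all_order all_algebra.
From mathcomp Require Import boolp classical_sets set_interval reals.
From mathcomp Require Import topology normedtype convex exp.
From mathcomp Require Import interval_inference sequences ring lra.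

Import Order.TTheory GRing.Theory Num.Theory.
Import numFieldNormedType.Exports.

Local Open Scope classical_set_scope.
Local Open Scope ring_scope.

(** Write [v = y - x] and let [p] be the Minkowski gauge of [v] with respect to
    the open convex set [Omega - x], so that [x + t v] is in [Omega] exactly when
    [t * p < 1] (for [t >= 0]). If the ray from [x] through [y] leaves [Omega],
    it does so at [a = x + v / p], and |x - a| / |y - a| = 1 / (1 - p); if it
    stays in [Omega], or if [x = y], then [p = 0]. In all cases
    [funk Omega x y = - ln (1 - p)] ([funkE]), so that the Funk metric can be
    computed with no further reference to the boundary of [Omega] or to the
    Euclidean norm.

    From this formula, the Funk metric is nonnegative and vanishes exactly when
    the ray stays in [Omega] ([funk_eq0]); since a line is the union of two
    opposite rays, [hilbert Omega x y > 0] exactly when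
    [line x y] is not contained in [Omega] ([hilbert_gt0]). The triangle inequality
    becomes the multiplicative inequality [(1 - p) (1 - q) <= 1 - r] between the
    gauges of the three pairs ([gauge_triangle]), which follows from convexity.
    It is an equality on a segment, where the gauges of the two parts are
    explicit functions of the gauge of the whole ([gauge_scale],
    [gauge_shift]). Finally, on a segment from a point of [Omega] to a point
    outside of it, the gauge takes every value [p] with [0 <= p < 1], so that
    [- ln (1 - p)] is unbounded ([funk_unbounded]). The Hilbert metric inherits
    all of this by symmetrization. *)

Set Implicit Arguments.
Unset Strict Implicit.

Lemma le_mul_of_lt (R : realFieldType) (a b e : R) : 0 < a -> 0 < b ->
  (forall c d, 0 <= c < a -> 0 <= d < b -> c * d < e) -> a * b <= e.
Proof.
move=> a0 b0 H; rewrite leNgt; apply/negP => eab.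
have e0 : 0 < e by rewrite -(mul0r 0); apply: H; rewrite lexx.
have /midf_lt[ec ca] : e / b < a by rewrite ltr_pdivrMr.
set c := (e / b + a) / 2 in ec ca.
have c0 : 0 < c by apply: lt_trans ec; rewrite divr_gt0.
have /midf_lt[ed db] : e / c < b.
  by rewrite ltr_pdivrMr// mulrC -ltr_pdivrMr.
set d := (e / c + b) / 2 in ed db.
have d0 : 0 < d by apply: lt_trans ed; rewrite divr_gt0.
have := H c d; rewrite ca db (ltW c0) (ltW d0) => /(_ isT isT).
by apply/negP; rewrite -leNgt ltW// mulrC -ltr_pdivrMr.
Qed.

(** * Convex sets and rays *)

Lemma convex_set_segment (R : numDomainType) (M : lmodType R) (A : set M)
    (x y : M) (t : R) :
  convex_set A -> A x -> A y -> 0 <= t <= 1 -> A (x + t *: (y - x)).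
Proof.
move=> cA Ax Ay /andP[t0 t1].
have := cA y x (Itv01 t0 t1); rewrite !inE => /(_ Ay Ax).
suff -> : x + t *: (y - x) = t *: y + (1 - t) *: x by [].
by rewrite scalerBr scalerBl scale1r addrCA.
Qed.

(** A convex set containing a point of a ray issued from one of its points
    contains everything in between. *)
Lemma convex_set_ray_le (R : numFieldType) (M : lmodType R) (A : set M)
    (x v : M) (s t : R) :
  convex_set A -> A x -> A (x + t *: v) -> 0 <= s <= t -> A (x + s *: v).
Proof.
move=> cA Ax At /andP[s0 st].
have [t0|tn0] := eqVneq t 0.
  have -> : s = 0 by apply/eqP; rewrite eq_le s0 -t0 st.
  by rewrite scale0r addr0.
have tgt0 : 0 < t by rewrite lt_neqAle eq_sym tn0 (le_trans s0 st).
have : A (x + (s / t) *: ((x + t *: v) - x)).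
  apply: convex_set_segment => //.
  by rewrite divr_ge0 ?(ltW tgt0)//= ler_pdivrMr// mul1r.
by rewrite (addrC x (t *: v)) addrK scalerA mulfVK.
Qed.

Section OpenConvex.
Context {R : realType} {V : normedModType R}.
Implicit Types (Omega : set V) (x w v : V) (t : R).

Lemma open_ray_extend Omega x v t :
  open Omega -> Omega (x + t *: v) ->
  exists2 e : R, 0 < e & Omega (x + (t + e) *: v).
Proof.
move=> oO Ot.
have c : (fun u : R => x + u *: v) @ t --> x + t *: v.
  by apply: cvgD; [exact: cvg_cst | apply: cvgZr_tmp; exact: cvg_id].
have /c /nbhs_ballP[d /= d0 dO] : nbhs (x + t *: v) Omega.
  by apply: open_nbhs_nbhs.
exists (d / 2); first by rewrite divr_gt0.
apply: dO; rewrite -ball_normE /= opprD addNKr normrN gtr0_norm ?divr_gt0//.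
by rewrite ltr_pdivrMr// ltr_pMr// ltr1n.
Qed.

(** The half-open segment from an interior point to a closure point stays
    inside the set. *)
Lemma open_convex_closure_segment Omega x w t :
  open Omega -> convex_set Omega -> Omega x -> closure Omega w ->
  0 <= t < 1 -> Omega (x + t *: (w - x)).
Proof.
move=> oO cO Ox cw /andP[t0 t1].
have t1n0 : 1 - t != 0 by rewrite subr_eq0 gt_eqF.
(* For b near w the point a = x + k (w - b) is near x, hence in Omega, and
   x + t (w - x) is the convex combination (1 - t) a + t b. *)
pose k := t / (1 - t).
have c : (fun b : V => x + k *: (w - b)) @ w --> x.
  rewrite -[X in _ --> X](_ : x + k *: (w - w) = x); last first.
    by rewrite subrr scaler0 addr0.
  apply: cvgD; first by apply: cvg_cst.
  apply: cvgZ; first by apply: cvg_cst.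
  apply: cvgB; first by apply: cvg_cst.
  exact: cvg_id.
have [b [Ob /= Oxb]] : Omega `&` (fun b => x + k *: (w - b)) @^-1` Omega !=set0.
  have /c : nbhs x Omega by apply: open_nbhs_nbhs.
  exact: cw.
have -> : x + t *: (w - x) =
    (x + k *: (w - b)) + t *: (b - (x + k *: (w - b))).
  have kt : (1 - t) * k = t by rewrite mulrC divfK.
  set a := x + k *: (w - b).
  have -> : a + t *: (b - a) = (1 - t) *: a + t *: b.
    by rewrite scalerBr scalerBl scale1r addrA addrAC.
  rewrite /a [in RHS]scalerDr scalerA kt !scalerBr scalerBl scale1r.
  by rewrite -!addrA addNr addr0 (addrC (t *: w)).
by apply: convex_set_segment => //; rewrite t0 ltW.
Qed.

End OpenConvex.

(** * The gauge of a pair of points *)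

Section Gauge.
Context {R : realType} {n : nat}.
Implicit Types (Omega : set 'rV[R]_n) (x y z v w : 'rV[R]_n) (p q r s t : R).

(** [is_gauge Omega x y p] says that [p] is the Minkowski gauge of [y - x]
    with respect to the open convex set [Omega - x]: the point of parameter
    [t] on the ray from [x] through [y] is in [Omega] exactly when [t * p < 1].
    If the ray leaves [Omega], it does so at parameter [p^-1]; if it stays
    in [Omega], the gauge is [0]. *)
Definition is_gauge Omega x y p : Prop :=
  0 <= p /\ forall t, 0 <= t -> (Omega (x + t *: (y - x)) <-> t * p < 1).

Lemma gauge_exists Omega x y :
  open Omega -> convex_set Omega -> Omega x -> exists p, is_gauge Omega x y p.
Proof.
move=> oO cO Ox.
(* When E is bounded, its supremum is the exit parameter, the inverse of the
   gauge; otherwise the gauge is 0. *)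
pose E := [set t : R | 0 <= t /\ Omega (x + t *: (y - x))].
have E0 : E 0 by split => //; rewrite scale0r addr0.
have Elt t e : 0 <= t -> t < e -> E e -> Omega (x + t *: (y - x)).
  move=> t0 te [_ Oe]; apply: (convex_set_ray_le cO Ox Oe) => //.
  by rewrite t0 ltW.
have Eopen t : E t -> exists2 e : R, t < e & E e.
  move=> [t0 Ot]; have [d d0 Od] := open_ray_extend oO Ot.
  exists (t + d); first by rewrite ltrDl.
  by split => //; rewrite addr_ge0// ltW.
have [ubE|nubE] := pselect (has_ubound E); last first.
  exists 0; split => // t t0; rewrite mulr0 ltr01; split => // _.
  apply: contrapT => nOt; apply: nubE; exists t => e Ee.
  by rewrite leNgt; apply/negP => te; apply: nOt; exact: (Elt _ e).
have hsE : has_sup E by split => //; exists 0.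
have sup_ge e : E e -> e <= sup E by move=> Ee; exact: ub_le_sup.
have sup_gt0 : 0 < sup E.
  by have [e e0 Ee] := Eopen _ E0; exact: (lt_le_trans e0 (sup_ge _ Ee)).
exists (sup E)^-1; split; first by rewrite invr_ge0 ltW.
move=> t t0; rewrite ltr_pdivrMr// mul1r; split => [Ot|tlt].
  have [|e te Ee] := Eopen t; first by split.
  exact: (lt_le_trans te (sup_ge _ Ee)).
have [|e Ee] := @sup_adherent _ E (sup E - t) _ hsE; first by rewrite subr_gt0.
by rewrite subKr => te; exact: (Elt _ e).
Qed.

Lemma gauge_mem Omega x y p : is_gauge Omega x y p -> (Omega y <-> p < 1).
Proof.
move=> [_ /(_ 1 ler01)]; rewrite scale1r mul1r.
by rewrite addrC subrK.
Qed.

Lemma gauge_lt1 Omega x y p : is_gauge Omega x y p -> Omega y -> p < 1.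
Proof. by move=> g Oy; apply/(gauge_mem g). Qed.

Lemma gauge0_ray Omega x y : is_gauge Omega x y 0 <-> ray x y `<=` Omega.
Proof.
split=> [[_ g] _ [t /= t0 <-]|rO].
  by apply/g => //; rewrite mulr0 ltr01.
split=> // t t0; rewrite mulr0 ltr01; split=> // _.
by apply: rO; exists t.
Qed.

Lemma gauge_ray0 Omega x y p :
  is_gauge Omega x y p -> ray x y `<=` Omega -> p = 0.
Proof.
move=> [p0 g] rO; apply/eqP; rewrite eq_le p0 andbT leNgt; apply/negP => pgt0.
have pV0 : 0 <= p^-1 by rewrite invr_ge0.
suff : p^-1 * p < 1 by rewrite mulVf ?gt_eqF// ltxx.
by apply/(g _ pV0)/rO; exists p^-1.
Qed.

(** * The Funk metric in terms of the gauge *)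

Lemma euclid_normZ t v : euclid_norm (t *: v) = `|t| * euclid_norm v.
Proof.
rewrite /euclid_norm -sqrtr_sqr -sqrtrM ?sqr_ge0// mulr_sumr.
by congr Num.sqrt; apply: eq_bigr => i _; rewrite mxE exprMn.
Qed.

Lemma euclid_norm_eq0 v : euclid_norm v = 0 -> v = 0.
Proof.
move=> /eqP; rewrite /euclid_norm sqrtr_eq0 => v0.
have /eqP : \sum_(i < n) v ord0 i ^+ 2 = 0.
  by apply/eqP; rewrite eq_le v0 sumr_ge0// => i _; exact: sqr_ge0.
rewrite psumr_eq0; last by move=> i _; exact: sqr_ge0.
move=> /allP v0'; apply/rowP => i; rewrite mxE; apply/eqP.
by have := v0' i (mem_index_enum _); rewrite /= sqrf_eq0.
Qed.

(** The exit point of a ray on which the gauge is positive. *)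
Lemma ray_boundaryE Omega x y p :
  open Omega -> convex_set Omega -> Omega x -> is_gauge Omega x y p -> 0 < p ->
  ray x y `&` boundary Omega = [set x + p^-1 *: (y - x)].
Proof.
move=> oO cO Ox [p0 g] pgt0.
have pn0 : p != 0 by rewrite gt_eqF.
have pV0 : 0 <= p^-1 by rewrite invr_ge0.
rewrite /boundary (interior_id _).1//.
apply/seteqP; split => [_ [[t /= t0 <-] [ct nOt]]|_ ->].
  suff -> : t = p^-1 by [].
  apply/eqP; rewrite eq_le; apply/andP; split; last first.
    by rewrite -[leLHS]mul1r ler_pdivrMr// leNgt; apply/negP => /(g _ t0).
  rewrite leNgt; apply/negP => pt.
  have tgt0 : 0 < t by rewrite (lt_trans _ pt)// invr_gt0.
  (* A boundary point beyond parameter p^-1 would force the point at p^-1 to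
     be in Omega. *)
  have := @open_convex_closure_segment _ _ _ _ _ (p^-1 / t) oO cO Ox ct.
  rewrite (addrC x (t *: _)) addrK scalerA mulfVK ?gt_eqF// => h.
  suff : p^-1 * p < 1 by rewrite mulVf// ltxx.
  apply/(g _ pV0)/h.
  by rewrite divr_ge0 ?invr_ge0//= ltr_pdivrMr// mul1r.
split; first by exists p^-1.
split; last by move=> /(g _ pV0); rewrite mulVf// ltxx.
move=> B.
have c : (fun u : R => x + u *: (y - x)) @ p^-1 --> x + p^-1 *: (y - x).
  by apply: cvgD; [exact: cvg_cst | apply: cvgZr_tmp; exact: cvg_id].
move=> /c /nbhs_ballP[d /= d0 dB].
(* The point at parameter p^-1 - m is in Omega and in the neighborhood B. *)
pose m := Num.min (d / 2) p^-1.
have m0 : 0 < m by rewrite lt_min divr_gt0//= invr_gt0.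
have mp : m <= p^-1 by rewrite ge_min lexx orbT.
have md : m < d.
  by rewrite gt_min ltr_pdivrMr// ltr_pMr// ltr1n.
exists (x + (p^-1 - m) *: (y - x)); split; last first.
  by apply: dB; rewrite -ball_normE /= subKr gtr0_norm.
apply/g; first by rewrite subr_ge0.
by rewrite -ltr_pdivlMr// mul1r ltrBlDr ltrDl.
Qed.

Lemma funkE Omega x y p :
  open Omega -> convex_set Omega -> Omega x -> Omega y ->
  is_gauge Omega x y p -> funk Omega x y = - ln (1 - p).
Proof.
move=> oO cO Ox Oy gp; have p1 := gauge_lt1 gp Oy.
rewrite /funk; case: eqP => [xy|/eqP xy].
  rewrite (gauge_ray0 gp) ?subr0 ?ln1 ?oppr0// => _ [t _ <-].
  by rewrite -xy subrr scaler0 addr0.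
case: asboolP => [/(gauge_ray0 gp) ->|nray]; first by rewrite subr0 ln1 oppr0.
have pgt0 : 0 < p.
  rewrite lt_neqAle gp.1 andbT; apply/eqP => p0; apply: nray.
  by apply/gauge0_ray; rewrite p0.
have pn0 : p != 0 by rewrite gt_eqF.
have -> : exit_point Omega x y = x + p^-1 *: (y - x).
  rewrite /exit_point (ray_boundaryE _ _ _ gp)//.
  exact: xget_unique.
rewrite (_ : x - (x + _) = (- p^-1) *: (y - x)); last first.
  by apply/rowP => j; rewrite !mxE; ring.
rewrite (_ : y - (x + _) = (1 - p^-1) *: (y - x)); last first.
  by apply/rowP => j; rewrite !mxE; ring.
have nn0 : euclid_norm (y - x) != 0.
  apply: contra xy => /eqP/euclid_norm_eq0/eqP; by rewrite subr_eq0 eq_sym.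
rewrite !euclid_normZ normrN gtr0_norm ?invr_gt0//.
rewrite ltr0_norm; last by rewrite subr_lt0 invf_gt1.
rewrite -lnV ?posrE ?subr_gt0//; congr ln.
have p1n0 : 1 - p != 0 by rewrite subr_eq0 gt_eqF.
have pn1 : p - 1 != 0 by rewrite -opprB oppr_eq0.
by field; rewrite p1n0 pn0 nn0 pn1.
Qed.

Lemma funk_ge0 Omega x y :
  open Omega -> convex_set Omega -> Omega x -> Omega y -> 0 <= funk Omega x y.
Proof.
move=> oO cO Ox Oy; have [p gp] := gauge_exists y oO cO Ox.
by rewrite (funkE oO cO Ox Oy gp) oppr_ge0 ln_le0// gerBl gp.1.
Qed.

Lemma funk_refl Omega x : funk Omega x x = 0.
Proof. by rewrite /funk eqxx. Qed.

Lemma funk_eq0 Omega x y :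
  open Omega -> convex_set Omega -> Omega x -> Omega y ->
  funk Omega x y = 0 <-> ray x y `<=` Omega.
Proof.
move=> oO cO Ox Oy; have [p gp] := gauge_exists y oO cO Ox.
have p1 := gauge_lt1 gp Oy.
rewrite (funkE oO cO Ox Oy gp); split => [/eqP|rO].
  rewrite oppr_eq0 ln_eq0 ?subr_gt0// => /eqP p0.
  by apply/gauge0_ray; rewrite (_ : 0 = p)//; lra.
by rewrite (gauge_ray0 gp rO) subr0 ln1 oppr0.
Qed.

(** * The triangle inequality *)

(** The exponential form of the triangle inequality for the Funk metric: if
    [y = c x + (1 - c) a] and [z = d y + (1 - d) b] with [a] and [b] in
    [Omega], then [z = c d x + (1 - c d) e] where [e], a convex combination of
    [a] and [b], is in [Omega]. *)
Lemma gauge_triangle Omega x y z p q r :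
  convex_set Omega -> Omega y -> Omega z ->
  is_gauge Omega x y p -> is_gauge Omega y z q -> is_gauge Omega x z r ->
  (1 - p) * (1 - q) <= 1 - r.
Proof.
move=> cO Oy Oz gp gq gr.
have p1 := gauge_lt1 gp Oy; have q1 := gauge_lt1 gq Oz.
apply: le_mul_of_lt => [||c d /andP[c0 cp] /andP[d0 dq]]; rewrite ?subr_gt0//.
have c1 : 0 < 1 - c by have := gp.1; lra.
have d1 : 0 < 1 - d by have := gq.1; lra.
have cd1 : 0 < 1 - c * d by nra.
have cd1n0 : 1 - c * d != 0 by rewrite gt_eqF.
have c1n0 : 1 - c != 0 by rewrite gt_eqF.
have d1n0 : 1 - d != 0 by rewrite gt_eqF.
have Oa : Omega (x + (1 - c)^-1 *: (y - x)).
  apply/gp.2; first by rewrite invr_ge0 ltW.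
  by rewrite mulrC ltr_pdivrMr// mul1r; lra.
have Ob : Omega (y + (1 - d)^-1 *: (z - y)).
  apply/gq.2; first by rewrite invr_ge0 ltW.
  by rewrite mulrC ltr_pdivrMr// mul1r; lra.
have : Omega (x + (1 - c * d)^-1 *: (z - x)).
  set a := x + _ in Oa; set b := y + _ in Ob.
  have -> : x + (1 - c * d)^-1 *: (z - x) =
      a + ((1 - d) / (1 - c * d)) *: (b - a).
    by apply/rowP => j; rewrite !mxE; field; rewrite cd1n0 c1n0 d1n0.
  apply: convex_set_segment => //.
  rewrite divr_ge0 ?(ltW d1) ?(ltW cd1)//= ler_pdivrMr// mul1r; nra.
move=> /gr.2; rewrite invr_ge0 (ltW cd1) mulrC ltr_pdivrMr// mul1r => /(_ isT).
lra.
Qed.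

Lemma funk_triangle Omega x y z :
  open Omega -> convex_set Omega -> Omega x -> Omega y -> Omega z ->
  funk Omega x z <= funk Omega x y + funk Omega y z.
Proof.
move=> oO cO Ox Oy Oz.
have [p gp] := gauge_exists y oO cO Ox.
have [q gq] := gauge_exists z oO cO Oy.
have [r gr] := gauge_exists z oO cO Ox.
rewrite (funkE oO cO Ox Oy gp) (funkE oO cO Oy Oz gq) (funkE oO cO Ox Oz gr).
have p1 := gauge_lt1 gp Oy; have q1 := gauge_lt1 gq Oz.
have r1 := gauge_lt1 gr Oz.
rewrite -opprD lerN2 -lnM ?posrE ?subr_gt0//.
rewrite ler_ln ?posrE ?mulr_gt0 ?subr_gt0//.
exact: (gauge_triangle cO Oy Oz gp gq gr).
Qed.

(** * Additivity along segments *)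

Lemma gauge_scale Omega x z t p : 0 <= t -> is_gauge Omega x z p ->
  is_gauge Omega x (x + t *: (z - x)) (t * p).
Proof.
move=> t0 [p0 g]; split; first exact: mulr_ge0.
move=> u u0; rewrite (addrC x (t *: _)) addrK scalerA mulrA.
by apply: g; exact: mulr_ge0.
Qed.

Lemma gauge_shift Omega x z t p : 0 <= t <= 1 -> t * p < 1 ->
  is_gauge Omega x z p ->
  is_gauge Omega (x + t *: (z - x)) z ((1 - t) * p / (1 - t * p)).
Proof.
move=> /andP[t0 t1] tp1 [p0 g].
have tp0 : 0 < 1 - t * p by rewrite subr_gt0.
split; first by rewrite !mulr_ge0 ?subr_ge0// invr_ge0 ltW.
move=> u u0.
have -> : x + t *: (z - x) + u *: (z - (x + t *: (z - x))) =
    x + (t + u * (1 - t)) *: (z - x).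
  by apply/rowP => j; rewrite !mxE; ring.
rewrite mulrA ltr_pdivrMr// mul1r ltrBrDl mulrA -mulrDl.
by apply: g; rewrite addr_ge0// mulr_ge0// subr_ge0.
Qed.

Lemma segment_sym x y : segment x y = segment y x.
Proof.
suff h (a b : 'rV[R]_n) : segment a b `<=` segment b a.
  by apply/seteqP; split; exact: h.
move=> _ [t t01 <-]; have /andP[t0 t1] : 0 <= t <= 1 := t01.
exists (1 - t) => /=; first by rewrite subr_ge0 t1 gerBl.
by apply/rowP => j; rewrite !mxE; ring.
Qed.

(** With [p] the gauge of [z - x] and [y = x + t (z - x)], the two gauges of
    [gauge_scale] and [gauge_shift] multiply out to
    [(1 - t p) (1 - (1 - t) p / (1 - t p)) = 1 - p]. *)
Lemma funk_segment Omega x y z :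
  open Omega -> convex_set Omega -> Omega x -> Omega z -> segment x z y ->
  funk Omega x z = funk Omega x y + funk Omega y z.
Proof.
move=> oO cO Ox Oz [t /= t01 yE].
have Oy : Omega y by rewrite -yE; exact: convex_set_segment.
have /andP[t0 t1] := t01.
have [p gp] := gauge_exists z oO cO Ox.
have gxy := gauge_scale t0 gp; rewrite yE in gxy.
have tp1 := gauge_lt1 gxy Oy.
have gyz := gauge_shift t01 tp1 gp; rewrite yE in gyz.
rewrite (funkE oO cO Ox Oy gxy) (funkE oO cO Oy Oz gyz) (funkE oO cO Ox Oz gp).
have tp0 : 0 < 1 - t * p by rewrite subr_gt0.
rewrite -opprD -lnM ?posrE//; last by rewrite subr_gt0 (gauge_lt1 gyz).
by congr (- ln _); field; rewrite gt_eqF.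
Qed.

(** * Separation and unboundedness *)

Lemma hilbert_gt0 Omega x y :
  open Omega -> convex_set Omega -> Omega x -> Omega y ->
  0 < hilbert Omega x y <-> ~ line x y `<=` Omega.
Proof.
move=> oO cO Ox Oy.
have f1 := funk_ge0 oO cO Ox Oy; have f2 := funk_ge0 oO cO Oy Ox.
rewrite /hilbert pmulr_rgt0 ?invr_gt0 ?ltr0n//; split => [h lO|nl].
  have e1 : funk Omega x y = 0.
    by apply/(funk_eq0 oO cO Ox Oy) => _ [t _ <-]; apply: lO; exists t.
  have e2 : funk Omega y x = 0.
    apply/(funk_eq0 oO cO Oy Ox) => _ [t _ <-]; apply: lO; exists (1 - t) => //.
    by apply/rowP => j; rewrite !mxE; ring.
  by rewrite e1 e2 addr0 ltxx in h.
rewrite lt0r (addr_ge0 f1 f2) andbT (paddr_eq0 f1 f2).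
apply/negP => /andP[/eqP/(funk_eq0 oO cO Ox Oy) rxy].
move=> /eqP/(funk_eq0 oO cO Oy Ox) ryx; apply: nl => _ [t _ <-].
have [t0|/ltW t0] := leP 0 t; first by apply: rxy; exists t.
have t1 : 0 <= 1 - t by rewrite subr_ge0 (le_trans t0).
apply: ryx; exists (1 - t); first exact: t1.
by apply/rowP => j; rewrite !mxE; ring.
Qed.

Lemma funk_unbounded Omega x (M : R) :
  open Omega -> convex_set Omega -> Omega x -> Omega <> setT ->
  exists2 y, Omega y & M < funk Omega x y.
Proof.
move=> oO cO Ox OT.
have [w nOw] : exists w, ~ Omega w.
  apply: contrapT => h; apply: OT; apply/seteqP; split => // w _.
  by apply: contrapT => nOw; apply: h; exists w.
have [p gp] := gauge_exists w oO cO Ox.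
have p1 : 1 <= p by rewrite leNgt; apply/negP => /(gauge_mem gp).
have p0 : 0 < p by exact: lt_le_trans p1.
(* The point of parameter t has gauge t * p and Funk distance
   - ln (1 - t * p) from x; this t makes the distance equal to |M| + 1. *)
pose t := (1 - expR (- (`|M| + 1))) / p.
have t0 : 0 <= t.
  by rewrite divr_ge0 ?(ltW p0)// subr_ge0 -[leRHS]expR0 ler_expR oppr_le0.
have tp : t * p = 1 - expR (- (`|M| + 1)) by rewrite /t divfK// gt_eqF.
have gy := gauge_scale t0 gp.
have Oy : Omega (x + t *: (w - x)).
  by apply/(gauge_mem gy); rewrite tp ltrBlDr ltrDl expR_gt0.
exists (x + t *: (w - x)) => //.
rewrite (funkE oO cO Ox Oy gy) tp subKr expRK opprK.
by rewrite (le_lt_trans (ler_norm M))// ltrDl.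
Qed.

End Gauge.

Unset Implicit Arguments.
Set Strict Implicit.

Theorem proposition12p2 (R : realType) (n : nat) (Omega : set 'rV[R]_n)
    (hOmega : convex_domain Omega) (hneq : Omega <> [set: 'rV[R]_n]) :
  (* (a) *)
  (forall x y, Omega x -> Omega y ->
     0 <= hilbert Omega x y /\ hilbert Omega x x = 0) /\
  (* (b) *)
  (forall x y z, Omega x -> Omega y -> Omega z ->
     hilbert Omega x z <= hilbert Omega x y + hilbert Omega y z) /\
  (* (c) *)
  (forall x y z, Omega x -> Omega z -> segment x z y ->
     hilbert Omega x z = hilbert Omega x y + hilbert Omega y z) /\
  (* (d) *)
  (forall x y, Omega x -> Omega y -> hilbert Omega x y = hilbert Omega y x) /\
  (* (e) *)
  ((forall x y, Omega x -> Omega y -> x <> y -> 0 < hilbert Omega x y) <->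
   ~ (exists p q : 'rV[R]_n, p <> q /\ line p q `<=` Omega)) /\
  (* (f) *)
  (forall M : R, exists x y, [/\ Omega x, Omega y & M < hilbert Omega x y]).
Proof.
have [[x0 Ox0] oO cO] := hOmega.
have hC x y : hilbert Omega x y = hilbert Omega y x.
  exact: (congr1 (fun u => 2^-1 * u) (addrC _ _)).
split=> [x y Ox Oy|].
  rewrite /hilbert !funk_refl addr0 mulr0; split=> //.
  by rewrite mulr_ge0 ?invr_ge0// addr_ge0// funk_ge0.
split=> [x y z Ox Oy Oz|].
  rewrite /hilbert -mulrDr ler_pM2l ?invr_gt0// addrACA [leRHS]addrACA.
  rewrite -addrACA; apply: lerD; first exact: funk_triangle.
  by rewrite addrC; exact: funk_triangle.
split=> [x y z Ox Oz xzy|].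
  have zxy : segment z x y by rewrite segment_sym.
  rewrite /hilbert (funk_segment oO cO Ox Oz xzy).
  rewrite (funk_segment oO cO Oz Ox zxy).
  have rearrange (a b c d : R) :
    2^-1 * ((a + b) + (c + d)) = 2^-1 * (a + d) + 2^-1 * (b + c) by ring.
  exact: rearrange.
split=> [x y _ _|]; first exact: hC.
split.
  split=> [sep [p [q [pq lO]]]|nl x y Ox Oy xy].
    have Op : Omega p by apply: lO; exists 0 => //; rewrite scale0r addr0.
    have Oq : Omega q by apply: lO; exists 1 => //; rewrite scale1r addrC subrK.
    by have /(hilbert_gt0 oO cO Op Oq) := sep _ _ Op Oq pq; apply.
  by apply/(hilbert_gt0 oO cO Ox Oy) => lO; apply: nl; exists x, y.
move=> M; have [y Oy My] := funk_unbounded (2 * M) oO cO Ox0 hneq.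
exists x0, y; split=> //.
rewrite /hilbert -ltr_pdivrMl ?invr_gt0// invrK (lt_le_trans My)// lerDl.
exact: funk_ge0.
Qed.
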